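(* Let $E=\{a,b\}$ be an alphabet of two letters, let $(w_k)_{k\ge 1}$ be the Fibonacci sequence in $E^*$ with $w_1=b$, $w_2=a$ (so $w_{k+2}=w_{k+1}w_k$), and let $f_{a,b}=\lim_{k\to\infty}w_k$. Let $\xi$ be an extremal real number and let $(W_k)_{k\ge 1}$ be a Fibonacci sequence in ${\mathcal{P}}$ associated to $\xi$. Let $\Phi\colon E^*\to{\mathcal{P}}$ be the morphism of monoids (with product $*$ on ${\mathcal{P}}$) with $\Phi(w_k)=W_k$ for each $k\ge1$ (i.e. $\Phi(b)=W_1$, $\Phi(a)=W_2$). For each $i\ge1$, let $u_i$ be the prefix of $f_{a,b}$ of length $i$ and put $U_i=\Phi(u_i)$. Then \[ \|(\xi,-1)U_i\| \asymp \frac{|\det U_i|}{\|U_i\|} \] with implied constants independent of $i$. Moreover, if the sequence $(\det U_i)_{i\ge1}$ is bounded, then $\xi$ is badly approximable.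
   Context: Let $\gamma=(1+\sqrt5)/2$. A real number $\xi$ is extremal if it is neither rational nor quadratic over $\mathbb{Q}$ and there is $c>0$ such that for every $X\ge1$ the system $|x_0|\le X$, $|x_0\xi-x_1|\le cX^{-1/\gamma}$, $|x_0\xi^2-x_2|\le cX^{-1/\gamma}$ has a non-zero integer solution. ${\mathcal{P}}$ is the set of primitive (entries with gcd 1) integer $2\times2$ matrices with non-zero determinant, a group under $A*B=(AB)^{\mathrm{red}}$, where $C^{\mathrm{red}}$ is $C$ divided by the positive gcd of its entries. A Fibonacci sequence in ${\mathcal{P}}$ satisfies $W_{i+2}=W_{i+1}*W_i$; it is admissible if there is $N\in{\mathcal{P}}$, neither symmetric nor skew-symmetric, with $W_iN_i$ symmetric for all $i$, where $N_i={}^tN$ for odd $i$ and $N_i=N$ for even $i$. With $\|A\|$ the max absolute value of entries, $(W_i)$ is associated to $\xi$ if it is unbounded, admissible and $\|W_{i+1}\|\asymp\|W_i\|^\gamma$, $\|(\xi,-1)W_i\|\asymp\|W_i\|^{-1}$, $|\det W_i|\asymp1$ with constants independent of $i$. A real $\xi$ is badly approximable if it is irrational and there is $c>0$ with $|\xi-p/q|>cq^{-2}$ for all $p/q\in\mathbb{Q}$. *)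

(* Defs.v *)
From HB Require Import structures.
From mathcomp Require Import all_boot all_order all_algebra.
From mathcomp Require Import all_classical all_reals all_analysis.
Set Implicit Arguments.
Unset Strict Implicit.
Unset Printing Implicit Defensive.
Import Order.TTheory GRing.Theory Num.Theory numFieldNormedType.Exports.
Local Open Scope classical_set_scope.
Local Open Scope ring_scope.

Section RealNumbers.
Variable R : realType.
Implicit Types (xi : R) (u v : nat -> R).

Definition golden : R := (1 + Num.sqrt 5) / 2.

Definition quadratic xi : Prop :=
  exists p : {poly rat},
    [/\ size p = 3%N, irreducible_poly p & root (map_poly ratr p) xi].

Definition extremal xi : Prop :=
  [/\ ~ rational xi, ~ quadratic xi
    & exists2 c : R, 0 < c & forall X : R, 1 <= X ->
        exists x0 x1 x2 : int,
          [/\ (x0, x1, x2) != (0, 0, 0),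
              `|x0%:~R| <= X,
              `|x0%:~R * xi - x1%:~R| <= c * X `^ (- golden^-1)
            & `|x0%:~R * xi ^+ 2 - x2%:~R| <= c * X `^ (- golden^-1)]].

Definition badly_approximable xi : Prop :=
  irrational xi /\
  exists2 c : R, 0 < c & forall p q : int, 0 < q ->
    `|xi - p%:~R / q%:~R| > c * q%:~R ^- 2.

(* All sequences are indexed by i >= 1; terms of index 0 are unconstrained. *)
Definition asymp u v : Prop :=
  exists c C : R, [/\ 0 < c, 0 < C
    & forall i, (1 <= i)%N -> c * v i <= u i <= C * v i].

End RealNumbers.

Definition entries_gcd (A : 'M[int]_2) : nat :=
  (\big[gcdn/0]_(ij : 'I_2 * 'I_2) `|A ij.1 ij.2|)%N.

Definition calP : {pred 'M[int]_2} :=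
  [pred A | (entries_gcd A == 1)%N && (\det A != 0)].

Definition reduced_mx (A : 'M[int]_2) : 'M[int]_2 :=
  map_mx (fun x => (x %/ (entries_gcd A)%:Z)%Z) A.

Definition star (A B : 'M[int]_2) : 'M[int]_2 := reduced_mx (A *m B).

Definition fibonacci_seq (W : nat -> 'M[int]_2) : Prop :=
  (forall i, (1 <= i)%N -> W i \in calP) /\
  (forall i, (1 <= i)%N -> W i.+2 = star (W i.+1) (W i)).

Definition admissible (W : nat -> 'M[int]_2) : Prop :=
  exists N : 'M[int]_2,
    [/\ N \in calP, N^T <> N, N^T <> - N
      & forall i, (1 <= i)%N ->
          let S := W i *m (if odd i then N^T else N) in S^T = S].

Section Association.
Variable R : realType.
Implicit Types (xi : R) (A : 'M[int]_2) (W : nat -> 'M[int]_2).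

(* The norm of a real matrix in the library is the maximum of the absolute
   values of its entries. *)
Definition mnorm A : R := `|map_mx intr A : 'M[R]_2|.

Definition linorm xi A : R :=
  `|(\row_(j < 2) [:: xi; -1]`_j) *m (map_mx intr A : 'M[R]_2)|.

Definition absdet A : R := `|\det A|%:~R.

Definition associated xi W : Prop :=
  [/\ fibonacci_seq W,
      forall B : R, exists2 i, (1 <= i)%N & B < mnorm (W i),
      admissible W
    & [/\ asymp (fun i => mnorm (W i.+1)) (fun i => mnorm (W i) `^ golden R),
      asymp (fun i => linorm xi (W i)) (fun i => (mnorm (W i))^-1)
    & asymp (fun i => absdet (W i)) (fun=> 1)]].

End Association.

Variant letter := La | Lb.

(* The value at 0 is a dummy: the words are indexed from 1. *)
Fixpoint fib_word (k : nat) : seq letter :=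
  match k with
  | 0 => [::]
  | 1 => [:: Lb]
  | (k'.+1 as k1).+1 =>
      if k' is 0 then [:: La] else fib_word k1 ++ fib_word k'
  end.

Definition word_limit (w : nat -> seq letter) (f : nat -> letter) : Prop :=
  forall n, \forall k \near \oo, take n (w k) = mkseq f n.

Definition star_morphism (Phi : seq letter -> 'M[int]_2) : Prop :=
  [/\ forall u, Phi u \in calP, Phi [::] = 1%:M
    & {morph Phi : u v / u ++ v >-> star u v}].

Lemma fib_wordS k : fib_word k.+3 = fib_word k.+2 ++ fib_word k.+1.
Proof. by []. Qed.

Lemma size_fib_word k : (k < size (fib_word k.+2))%N.
Proof.
have pos j : (0 < size (fib_word j.+1))%N.
  by elim: j => [//|[//|j IH]]; rewrite fib_wordS size_cat ltn_addr.
elim: k => [//|k IH].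
by rewrite fib_wordS size_cat; have := leq_add IH (pos k); rewrite addn1.
Qed.

Lemma fib_word_limit :
  word_limit fib_word (fun n => nth La (fib_word n.+2) n).
Proof.
have pre k d : exists s, fib_word (d + k).+2 = fib_word k.+2 ++ s.
  elim: d => [|d [s IH]]; first by exists [::]; rewrite cats0.
  by exists (s ++ fib_word (d + k).+1); rewrite addSn fib_wordS IH catA.
move=> n; exists n.+2 => // k /= lenk.
have -> : k = ((k - n.+2) + n).+2.
  by rewrite -[LHS](subnK lenk) !addnS.
have [s ->] := pre n (k - n.+2)%N.
rewrite takel_cat; last exact: ltnW (size_fib_word n).
have sz : size (take n (fib_word n.+2)) = n.
  by rewrite size_takel // ltnW // size_fib_word.
apply: (@eq_from_nth _ La); first by rewrite sz size_mkseq.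
rewrite sz => i ltin; rewrite nth_take // nth_mkseq //.
have [t] := pre i (n - i)%N; rewrite subnK 1?ltnW // => ->.
by rewrite nth_cat size_fib_word.
Qed.

(* Main.v *)
(* Complete the prefix u_i to a word w_m = u_i v, so that, up to scalars,
   W_m = U_i V.  Since (xi, -1) U_i det V = (xi, -1) W_m adj V, the upper bound
   for U_i follows from the one for W_m once |U_i| |V| = O(|W_m|), i.e. once
   there is no cancellation in the product U_i V.  For k large, admissibility of
   (W_i) and the fact that xi is neither rational nor quadratic put W_k and
   W_(k+1) close to rank one matrices (1, xi)^T r with r (1, xi)^T <> 0; hence
   both are positive, up to sign, in a basis of vectors close to (1, xi)^T.
   Since f_{a,b} is a concatenation of the words w_k and w_(k+1), cutting
   at i destroys only one such block, and products of positive matrices do not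
   cancel.  The lower bound is (xi, -1) det U = (xi, -1) U adj U. *)
Require Import Defs.
From mathcomp Require Import all_boot all_order all_algebra.
From mathcomp Require Import all_classical all_reals all_analysis.
From mathcomp Require Import zify ring lra.
Set Implicit Arguments.
Unset Strict Implicit.
Unset Printing Implicit Defensive.
Import Order.TTheory GRing.Theory Num.Theory numFieldNormedType.Exports.
Local Open Scope ring_scope.

(** * The maximum norm, and products without cancellation *)

Lemma mx_entry_le_norm (R : realType) (m n : nat) (A : 'M[R]_(m, n)) i j :
  `|A i j| <= `|A|.
Proof.
rewrite [leRHS]/Num.Def.normr /= mx_normrE; apply/bigmax_geP; right => /=.
by exists (i, j).
Qed.

Lemma mx_norm_leP (R : realType) (m n : nat) (A : 'M[R]_(m, n)) (K : R) :
  0 <= K -> (forall i j, `|A i j| <= K) -> `|A| <= K.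
Proof.
move=> K0 AK; rewrite [leLHS]/Num.Def.normr /= mx_normrE.
by apply: bigmax_le => // -[i j] _ /=.
Qed.

Lemma mx_norm_attained (R : realType) (m n : nat) (A : 'M[R]_(m.+1, n.+1)) :
  exists i j, `|A| = `|A i j|.
Proof.
have [A0|/(@mx_norm_neq0 _ _ _ A)[[i j] /= Aij]] := eqVneq `|A| 0; last first.
  by exists i, j.
by exists 0, 0; rewrite A0; move/eqP: A0; rewrite normr_eq0 => /eqP ->;
  rewrite mxE normr0.
Qed.

Lemma sum_ord2 (V : nmodType) (F : 'I_2 -> V) : \sum_i F i = F 0 + F 1.
Proof.
by rewrite big_ord_recl big_ord1; congr (_ + F _); apply: val_inj.
Qed.

Lemma forall_ord2 (P : 'I_2 -> Prop) : P 0 -> P 1 -> forall i, P i.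
Proof.
move=> P0 P1 [[|[|//]] Hi].
- by rewrite (_ : Ordinal Hi = 0) //; apply: val_inj.
- by rewrite (_ : Ordinal Hi = 1) //; apply: val_inj.
Qed.

Lemma mulmx2E (R : pzRingType) (m n : nat) (A : 'M[R]_(m, 2)) (B : 'M[R]_(2, n))
    i j :
  (A *m B) i j = A i 0 * B 0 j + A i 1 * B 1 j.
Proof. by rewrite mxE sum_ord2. Qed.

Lemma mx_norm_mul2 (R : realType) (m n : nat) (A : 'M[R]_(m, 2))
    (B : 'M[R]_(2, n)) :
  `|A *m B| <= 2 * `|A| * `|B|.
Proof.
apply: mx_norm_leP => [|i j]; first by rewrite !mulr_ge0.
rewrite mulmx2E (le_trans (ler_normD _ _)) // !normrM -mulrA mulr_natl mulr2n.
by apply: lerD; apply: ler_pM => //; apply: mx_entry_le_norm.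
Qed.

Lemma mx_norm_adj2 (R : realType) (A : 'M[R]_2) : `|\adj A| <= `|A|.
Proof.
apply: mx_norm_leP => // i j.
rewrite mxE /cofactor normrM normrX normrN1 expr1n mul1r det_mx11 !mxE.
exact: mx_entry_le_norm.
Qed.

(** From [v * det A = v A adj A], since the adjugate does not increase the norm. *)
Lemma norm_det_row (R : realType) (m : nat) (v : 'M[R]_(m, 2)) (A : 'M[R]_2) :
  `|\det A| * `|v| <= 2 * `|v *m A| * `|A|.
Proof.
rewrite -mx_normZ -mul_mx_scalar -mul_mx_adj mulmxA.
rewrite (le_trans (mx_norm_mul2 _ _)) // ler_wpM2l ?mulr_ge0 //.
exact: mx_norm_adj2.
Qed.

(** All terms of an entry of the product are non-negative, so one may keep only the term that joins
    a largest entry of [P] to a largest entry of [Q]. *)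
Lemma mx_norm_mul3_nonneg (R : realType) (mu : R) (P M Q : 'M[R]_2) :
  0 <= mu -> (forall i j, 0 <= P i j) -> (forall i j, mu <= M i j) ->
  (forall i j, 0 <= Q i j) ->
  mu * `|P| * `|Q| <= `|P *m M *m Q|.
Proof.
move=> mu0 P0 Mmu Q0.
have [i [k ->]] := mx_norm_attained P; have [l [j ->]] := mx_norm_attained Q.
apply: le_trans (mx_entry_le_norm _ i j).
rewrite (ger0_norm (P0 _ _)) (ger0_norm (Q0 _ _)); apply: le_trans (ler_norm _).
have M0 a b : 0 <= M a b by apply: le_trans (Mmu a b).
have PM0 a b : 0 <= (P *m M) a b.
  by rewrite mxE sumr_ge0 // => c _; rewrite mulr_ge0.
rewrite mxE (bigD1 l) //= -[leLHS]addr0 lerD ?sumr_ge0 //; last first.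
  by move=> a _; rewrite mulr_ge0.
rewrite ler_wpM2r // mxE (bigD1 k) //= -[leLHS]addr0 lerD ?sumr_ge0 //; last first.
  by move=> a _; rewrite mulr_ge0.
by rewrite mulrC ler_wpM2l.
Qed.

(* No cancellation occurs in P M Q if all three factors are non-negative, up to
   sign, in a common basis G. *)
Lemma mx_norm_mul3_conj (R : realType) (mu : R) (G H P M Q : 'M[R]_2)
    (p m q : bool) :
  0 < mu -> G *m H = 1%:M ->
  (forall i j, 0 <= ((-1) ^+ p *: (H *m P *m G)) i j) ->
  (forall i j, mu <= ((-1) ^+ m *: (H *m M *m G)) i j) ->
  (forall i j, 0 <= ((-1) ^+ q *: (H *m Q *m G)) i j) ->
  mu * `|P| * `|Q| <= (4 * `|G| * `|H|) ^+ 3 * `|P *m M *m Q|.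
Proof.
move=> mu0 GH P0 Mmu Q0.
set g := 4 * `|G| * `|H|.
have g0 : 0 <= g by rewrite !mulr_ge0.
have norm_sandwich (A B C : 'M[R]_2) : `|A *m B *m C| <= 4 * `|A| * `|B| * `|C|.
  rewrite (le_trans (mx_norm_mul2 _ _)) //.
  rewrite (_ : 4 * _ * _ * _ = 2 * (2 * `|A| * `|B|) * `|C|); last by ring.
  by rewrite ler_wpM2r // ler_wpM2l // mx_norm_mul2.
(* Each change of basis costs a factor [g]: twice backwards, for [P] and [Q], and once forwards, for
   the product; hence the cube. *)
have back (A : 'M[R]_2) (s : bool) :
    `|A| <= g * `|(-1) ^+ s *: (H *m A *m G)|.
  rewrite mx_normZ normrX normrN1 expr1n mul1r.
  have {1}-> : A = G *m (H *m A *m G) *m H.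
    by rewrite !mulmxA GH mul1mx -mulmxA GH mulmx1.
  by rewrite (le_trans (norm_sandwich _ _ _)) // /g mulrAC.
have HG A B : H *m A *m G *m (H *m B *m G) = H *m (A *m B) *m G.
  by rewrite !mulmxA -(mulmxA (H *m A) G H) GH mulmx1.
have := mx_norm_mul3_nonneg (ltW mu0) P0 Mmu Q0.
have := ler_pM (normr_ge0 _) (normr_ge0 _) (back P p) (back Q q).
set a := `|_ *: _|; set b := `|_ *: _| => PQ.
rewrite -!scalemxAl -!scalemxAr -!scalemxAl !scalerA mx_normZ !HG.
rewrite !normrM !normrX !normrN1 !expr1n !mul1r => main.
have fwd : `|H *m (P *m M *m Q) *m G| <= g * `|P *m M *m Q|.
  rewrite (le_trans (norm_sandwich _ _ _)) // /g.
  by rewrite le_eqVlt; apply/orP; left; apply/eqP; ring.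
rewrite -mulrA (le_trans (ler_wpM2l (ltW mu0) PQ)) //.
rewrite (_ : mu * _ = g ^+ 2 * (mu * a * b)); last by ring.
rewrite (exprSr g 2) -[leRHS]mulrA ler_wpM2l ?exprn_ge0 //.
exact: le_trans main fwd.
Qed.

(** * The linear form $(\xi,-1)$ and quadratic relations *)

(** If [p] is non-zero, the polynomial cannot be irreducible, so it has a rational root [x]; then
    [xi] is either [x] or the other root [- t / p - x], hence rational. *)
Lemma quadratic_relation0 (R : realType) (xi : R) (p t s : int) :
  ~ rational xi -> ~ quadratic xi ->
  p%:~R * xi ^+ 2 + t%:~R * xi + s%:~R = 0 -> [/\ p = 0, t = 0 & s = 0].
Proof.
move=> xiNrat xiNquad rel.
have [p0|pN0] := eqVneq p 0; last first.
  have pRN0 : p%:~R != 0 :> R by rewrite intr_eq0.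
  exfalso; apply: xiNquad.
  pose f : {poly rat} := (p%:~R%:P * 'X + t%:~R%:P) * 'X + s%:~R%:P.
  have root_f x : root (map_poly ratr f) x
      = ((p%:~R * x + t%:~R) * x + s%:~R == 0 :> R).
    rewrite /root /f !(rmorphD, rmorphM) /= !map_polyC map_polyX /= !ratr_int.
    by rewrite !hornerE.
  have size_f : size f = 3%N.
    have pQ0 : p%:~R != 0 :> rat by rewrite intr_eq0.
    have size1 : size (p%:~R%:P * 'X + t%:~R%:P : {poly rat}) = 2%N.
      by rewrite size_MXaddC polyC_eq0 (negPf pQ0) /= size_polyC pQ0.
    by rewrite /f size_MXaddC -size_poly_eq0 size1.
  exists f; split => //; last first.
    by rewrite root_f; apply/eqP; rewrite -[RHS]rel; ring.
  apply: cubic_irreducible; first by rewrite size_f.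
  move=> x; apply/negP => fx; apply: xiNrat.
  have : root (map_poly ratr f) (ratr x : R) by rewrite fmorph_root.
  rewrite root_f => /eqP relx.
  have /eqP : (xi - ratr x) * (p%:~R * (xi + ratr x) + t%:~R) = 0.
    by rewrite -[RHS](subrr 0) -{1}rel -relx; ring.
  rewrite mulf_eq0 subr_eq0 => /orP[/eqP ->|/eqP xi_x]; first by exists x.
  exists (- (t%:~R / p%:~R) - x) => //.
  rewrite rmorphB rmorphN fmorph_div /= !ratr_int.
  have -> : t%:~R = - (p%:~R * (xi + ratr x)).
    by apply/eqP; rewrite -subr_eq0 opprK addrC xi_x.
  by field.
move: rel; rewrite p0 mul0r add0r.
have [->|tN0] := eqVneq t 0.
  by rewrite mul0r add0r => /eqP; rewrite intr_eq0 => /eqP ->.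
have tRN0 : t%:~R != 0 :> R by rewrite intr_eq0.
move=> rel; exfalso; apply: xiNrat; exists (- (s%:~R / t%:~R)) => //.
rewrite rmorphN fmorph_div /= !ratr_int.
have -> : s%:~R = - (t%:~R * xi) by apply/eqP; rewrite -subr_eq0 opprK addrC rel.
by field.
Qed.

Lemma linform_entry (R : realType) (xi : R) (M : 'M[R]_2) (j : 'I_2) :
  ((\row_(j < 2) [:: xi; -1]`_j) *m M) 0 j = xi * M 0 j - M 1 j.
Proof. by rewrite mulmx2E !mxE /= mulN1r. Qed.

Lemma linform_entry_le (R : realType) (xi : R) (M : 'M[R]_2) (j : 'I_2) :
  `|xi * M 0 j - M 1 j| <= `|(\row_(j < 2) [:: xi; -1]`_j) *m M|.
Proof. by rewrite -linform_entry mx_entry_le_norm. Qed.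

Lemma linform_neq0 (R : realType) (xi : R) :
  (\row_(j < 2) [:: xi; -1]`_j : 'rV[R]_2) != 0.
Proof.
apply/eqP => /matrixP/(_ 0 1); rewrite !mxE /= => /eqP.
by rewrite oppr_eq0 oner_eq0.
Qed.

(* The columns of M are nearly proportional to (1, xi), so symmetry of M N
   forces the first row of M to be nearly proportional to
   (s - xi r, xi p - q), where N = [[p, q], [r, s]]; the quadratic form below
   is the value of that row at (1, xi). *)
Lemma mx_norm_le_row (R : realType) (xi : R) (N : 'M[R]_2) :
  xi ^+ 2 * N 0 0 - xi * (N 0 1 + N 1 0) + N 1 1 != 0 ->
  exists2 K : R, 0 < K & forall M : 'M[R]_2, (M *m N)^T = M *m N ->
    `|M| <= K * (`|M 0 0 + M 0 1 * xi| + `|(\row_(j < 2) [:: xi; -1]`_j) *m M|).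
Proof.
set p := N 0 0; set q := N 0 1; set r := N 1 0; set s := N 1 1.
set d := (X in X != 0) => d0.
pose a := q - xi * p.
pose K1 := (`|p| + `|r| + `|a|) / `|d|.
have K10 : 0 <= K1 by rewrite divr_ge0 // !addr_ge0.
pose z := `|xi|.
have z0 : 0 <= z by apply: normr_ge0.
pose Ka := 1 + K1 * z.
have Ka0 : 0 <= Ka by rewrite addr_ge0 ?mulr_ge0.
exists (Ka + K1 + (z * Ka + 1) + (z * K1 + 1)).
  have : 0 <= z * Ka by rewrite mulr_ge0.
  have : 0 <= z * K1 by rewrite mulr_ge0.
  lra.
move=> M /matrixP/(_ 0 1); rewrite !mxE !sum_ord2 -/p -/q -/r -/s => sym.
set sg := `|_ + _|; set L := `|_ *m _|.
have e0 := linform_entry_le xi M 0; have e1 := linform_entry_le xi M 1.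
rewrite -/L in e0 e1.
set T := sg + L.
have sg0 : 0 <= sg by apply: normr_ge0.
have L0 : 0 <= L by apply: normr_ge0.
have T0 : 0 <= T by apply: addr_ge0.
have LT : L <= T by rewrite /T lerDr.
have sgT : sg <= T by rewrite /T lerDl.
have b_le : `|M 0 1| <= K1 * T.
  rewrite /K1 mulrAC ler_pdivlMr ?normr_gt0 // -normrM.
  (* The only use of symmetry: modulo that relation, [M 0 1 * d] is a combination of small
     quantities. The other three entries are then recovered from [M 0 1]. *)
  have -> : M 0 1 * d = - p * (xi * M 0 0 - M 1 0) - r * (xi * M 0 1 - M 1 1)
      - a * (M 0 0 + M 0 1 * xi).
    suff : M 0 0 * q + M 0 1 * s - (M 1 0 * p + M 1 1 * r) = 0.
      by move=> h; apply/eqP; rewrite -subr_eq0 -h /d /a; apply/eqP; ring.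
    by rewrite sym subrr.
  rewrite !(mulrDl _ _ T) (le_trans (ler_normB _ _)) // lerD //; last first.
    by rewrite normrM ler_wpM2l.
  rewrite (le_trans (ler_normB _ _)) // lerD // normrM ?normrN ler_wpM2l //.
    exact: le_trans LT.
  exact: le_trans LT.
have a_le : `|M 0 0| <= Ka * T.
  have -> : M 0 0 = (M 0 0 + M 0 1 * xi) - M 0 1 * xi by ring.
  rewrite (le_trans (ler_normB _ _)) // /Ka mulrDl mul1r lerD // normrM.
  by rewrite mulrAC ler_wpM2r.
have lower j k : `|M 0 j| <= k * T -> `|M 1 j| <= (z * k + 1) * T.
  move=> h.
  have -> : M 1 j = xi * M 0 j - (xi * M 0 j - M 1 j) by ring.
  rewrite (le_trans (ler_normB _ _)) // mulrDl mul1r lerD //.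
    by rewrite normrM -mulrA ler_wpM2l.
  exact: le_trans (linform_entry_le xi M j) LT.
have c_le := lower _ _ a_le; have d_le := lower _ _ b_le.
have zKa0 : 0 <= z * Ka + 1 by rewrite addr_ge0 ?mulr_ge0.
have zK0 : 0 <= z * K1 + 1 by rewrite addr_ge0 ?mulr_ge0.
have KaT := mulr_ge0 Ka0 T0. have K1T := mulr_ge0 K10 T0.
have zKaT := mulr_ge0 zKa0 T0. have zKT := mulr_ge0 zK0 T0.
clearbody Ka K1 T.
rewrite !(mulrDl _ _ T).
rewrite !(mulrDl _ _ T) in zKaT zKT c_le d_le.
apply: mx_norm_leP; first by lra.
by apply: forall_ord2; apply: forall_ord2; lra.
Qed.

(** * Positivity in a basis close to $(1,\xi)$ *)

Section Cone.
Variables (R : realType) (xi eta : R).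

(* The columns of cone_mx span a narrow cone around the direction (1, xi). *)
Definition cone_mx : 'M[R]_2 :=
  \matrix_(i, j) if i == 0 then 1 else xi + (-1) ^+ j * eta.

Definition cone_inv : 'M[R]_2 :=
  \matrix_(i, j) if j == 0 then (1 - (-1) ^+ i * xi / eta) / 2
                 else (-1) ^+ i / eta / 2.

Hypothesis eta_gt0 : 0 < eta.

Lemma cone_mxK : cone_mx *m cone_inv = 1%:M.
Proof.
have etaN0 : eta != 0 by rewrite gt_eqF.
apply/matrixP; apply: forall_ord2; apply: forall_ord2;
  rewrite mulmx2E !mxE /= ?expr0 ?expr1; field => //.
Qed.

(** The term [M 0 0 + M 0 1 * xi] is common to the four entries; the others are of order
    [eta * |M|], or of order $1/\eta$ times the linear form. *)
Lemma cone_conjE (M : 'M[R]_2) i j :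
  (cone_inv *m M *m cone_mx) i j =
  ((M 0 0 + M 0 1 * xi) + ((-1) ^+ j * (M 0 1 * eta) - (-1) ^+ i *
   ((xi * M 0 0 - M 1 0) + (xi * M 0 1 - M 1 1) * (xi + (-1) ^+ j * eta)) / eta))
  / 2.
Proof.
have etaN0 : eta != 0 by rewrite gt_eqF.
rewrite !mulmx2E !mxE /=.
move: ((-1) ^+ i) ((-1) ^+ j) => x y.
by field.
Qed.

End Cone.

(** With [eta = 1 / (4 * K)] the error [eta * |M|] is a quarter of [|M| / K], while the common term
    is at least [|M| / K - L] in absolute value. For [|M|] large it dominates and gives its sign to
    all entries. *)
Lemma cone_conj_ge1 (R : realType) (xi K L : R) : 0 < K -> 0 < L ->
  exists2 eta : R, 0 < eta & exists B : R, forall M : 'M[R]_2,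
    `|M| <= K * (`|M 0 0 + M 0 1 * xi| + `|(\row_(j < 2) [:: xi; -1]`_j) *m M|) ->
    `|(\row_(j < 2) [:: xi; -1]`_j) *m M| <= L -> B <= `|M| ->
    exists s : bool, forall i j,
      1 <= ((-1) ^+ s *: (cone_inv xi eta *m M *m cone_mx xi eta)) i j.
Proof.
move=> K0 L0; pose eta := (4 * K)^-1.
have eta0 : 0 < eta by rewrite invr_gt0 mulr_gt0.
exists eta => //.
pose E := (L + L * (`|xi| + eta)) / eta.
exists (4 * K * (L + E + 2)) => M.
set sg := M 0 0 + M 0 1 * xi; set l := `|_ *m M| => MK lL MB.
exists (sg < 0) => i j.
rewrite mxE cone_conjE //.
rewrite -/sg mulrA mulrDr -[_ * sg]normrEsign ler_pdivlMr //.
set e := _ - _.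
have e_le : `|e| <= eta * `|M| + E.
  rewrite /e (le_trans (ler_normB _ _)) // lerD //.
    rewrite !normrM normrX normrN1 expr1n mul1r mulrC (gtr0_norm eta0).
    by rewrite ler_wpM2l ?(ltW eta0) // mx_entry_le_norm.
  rewrite 2!normrM normrX normrN1 expr1n mul1r normfV (gtr0_norm eta0).
  rewrite /E ler_pM2r ?(invr_gt0 eta) // (le_trans (ler_normD _ _)) // lerD //.
    exact: le_trans (linform_entry_le xi M 0) lL.
  rewrite normrM ler_pM //; first exact: le_trans (linform_entry_le xi M 1) lL.
  rewrite (le_trans (ler_normD _ _)) // lerD // normrM normrX normrN1 expr1n.
  by rewrite mul1r (gtr0_norm eta0).
have signed_e : - `|e| <= (-1) ^+ (sg < 0)%R * e.
  by rewrite lerNl (le_trans (ler_norm _)) // normrN normrM normrX normrN1 expr1n mul1r.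
have M_le : `|M| / K <= `|sg| + L.
  by rewrite ler_pdivrMr // mulrC (le_trans MK) // ler_pM2l // lerD2l.
have etaM : eta * `|M| = `|M| / K / 4 by rewrite /eta invfM; ring.
have MKB : 4 * (L + E + 2) <= `|M| / K.
  by rewrite ler_pdivlMr // (le_trans _ MB) // le_eqVlt; apply/orP; left; apply/eqP; ring.
have E0 : 0 <= E.
  by rewrite /E divr_ge0 ?(ltW eta0) // addr_ge0 ?mulr_ge0 ?addr_ge0 ?(ltW L0) ?(ltW eta0).
clearbody E; lra.
Qed.

Lemma sign_nonneg_conjM (R : realType) (G H A B : 'M[R]_2) (a b : bool) :
  G *m H = 1%:M ->
  (forall i j, 0 <= ((-1) ^+ a *: (H *m A *m G)) i j) ->
  (forall i j, 0 <= ((-1) ^+ b *: (H *m B *m G)) i j) ->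
  forall i j, 0 <= ((-1) ^+ (a (+) b) *: (H *m (A *m B) *m G)) i j.
Proof.
move=> GH A0 B0 i j.
have -> : H *m (A *m B) *m G = H *m A *m G *m (H *m B *m G).
  by rewrite !mulmxA -(mulmxA (H *m A) G H) GH mulmx1.
rewrite signr_addb -scalerA scalemxAr scalemxAl mxE sumr_ge0 // => k _.
by rewrite mulr_ge0.
Qed.

(** * Cutting Fibonacci words into blocks *)

Section FlattenSplit.
Variables (S T : Type) (g : S -> seq T).

Lemma flatten_map_split (bs : seq S) i : (i < size (flatten (map g bs)))%N ->
  exists bs1 b bs2 j,
    [/\ bs = bs1 ++ b :: bs2,
        take i (flatten (map g bs)) = flatten (map g bs1) ++ take j (g b)
      & drop i (flatten (map g bs)) = drop j (g b) ++ flatten (map g bs2)].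
Proof.
elim: bs i => [//|b bs IH] i /=; rewrite size_cat => lti.
have [ib|bi] := ltnP i (size (g b)).
  exists [::], b, bs, i; split => //=; first by rewrite takel_cat // ltnW.
  by rewrite drop_cat ib.
have [|bs1 [c [bs2 [j [-> takeE dropE]]]]] := IH (i - size (g b))%N.
  by rewrite ltn_subLR.
exists (b :: bs1), c, bs2, j; split => //=.
  by rewrite take_cat ltnNge bi /= -catA -takeE.
by rewrite drop_cat ltnNge bi /= -dropE.
Qed.

End FlattenSplit.

(** The recursion has depth two, so the induction carries two consecutive values of [d]. The
    recursion holds only from index 1 on, whence [0 < k]. *)
Lemma fib_word_blocks k d : (0 < k)%N ->
  exists bs : seq bool, fib_word (d + k) = flatten [seq fib_word (k + b) | b : bool <- bs].
Proof.
case: k => // k _.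
suff: (exists bs : seq bool,
         fib_word (d + k.+1) = flatten [seq fib_word (k.+1 + b) | b : bool <- bs]) /\
      (exists bs : seq bool,
         fib_word (d.+1 + k.+1) = flatten [seq fib_word (k.+1 + b) | b : bool <- bs]).
  by case.
elim: d => [|d [[bs E] [cs F]]].
  by split; [exists [:: false]|exists [:: true]]; rewrite /= cats0 ?addn0 ?addn1.
split; first by exists cs.
exists (cs ++ bs); rewrite map_cat flatten_cat -E -F.
by rewrite !addSn !addnS fib_wordS.
Qed.

(** * Reduced and unreduced products *)

Lemma entries_gcd_scale (A : 'M[int]_2) :
  A = (entries_gcd A)%:Z *: reduced_mx A.
Proof.
apply/matrixP => i j; rewrite !mxE mulrC divzK //.
rewrite dvdzE absz_nat /entries_gcd (bigD1 (i, j)) //=.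
exact: dvdn_gcdl.
Qed.

Lemma gcd_mul_gt0 (A B : 'M[int]_2) : A \in calP -> B \in calP ->
  (0 < entries_gcd (A *m B))%N.
Proof.
move=> /andP[_ dA] /andP[_ dB]; rewrite lt0n.
apply: contraNneq (mulf_neq0 dA dB) => g0.
by rewrite -det_mulmx (entries_gcd_scale (_ *m _)) g0 scale0r det0.
Qed.

Section RealProduct.
Variables (R : realType) (Phi : seq letter -> 'M[int]_2).

(** The product without reduction is multiplicative for [*m], so that norms of products can be
    compared without tracking the gcds removed by [star]. *)
Definition real_prod (u : seq letter) : 'M[R]_2 :=
  foldr (fun l M => map_mx intr (Phi [:: l]) *m M) 1%:M u.

Lemma real_prod_cat u v : real_prod (u ++ v) = real_prod u *m real_prod v.
Proof. by elim: u => [|l u IH] /=; rewrite ?mul1mx // IH mulmxA. Qed.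

(** Meant for the two pieces of a cut block, whose lengths are bounded. *)
Lemma real_prod_norm_le :
  exists2 D : R, 1 <= D & forall u, `|real_prod u| <= D ^+ size u.
Proof.
pose nl l : R := `|map_mx intr (Phi [:: l]) : 'M[R]_2|.
have nl0 l : 0 <= nl l by apply: normr_ge0.
exists (1 + 2 * (nl La + nl Lb)); first by rewrite lerDl mulr_ge0 ?addr_ge0.
elim=> [|l u IH] /=.
  rewrite expr0; apply: mx_norm_leP => // i j.
  by rewrite mxE; case: eqP => _; rewrite ?normr1 ?normr0.
rewrite (le_trans (mx_norm_mul2 _ _)) // exprS ler_pM ?mulr_ge0 //.
by rewrite -/(nl l); have := nl0 La; have := nl0 Lb; case: l; lra.
Qed.

Hypothesis HPhi : star_morphism Phi.

(** The scalar is a product of the gcds removed by [star]. That it is at least 1 preserves lower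
    bounds on entries. *)
Lemma real_prod_scale u :
  exists2 lam : R, 1 <= lam & real_prod u = lam *: map_mx intr (Phi u).
Proof.
have [PhiP Phi0 PhiM] := HPhi.
elim: u => [|l u [lam lam1 IH]] /=.
  by exists 1 => //; rewrite Phi0 map_mx1 scale1r.
have g_gt0 := gcd_mul_gt0 (PhiP [:: l]) (PhiP u).
exists (lam * (entries_gcd (Phi [:: l] *m Phi u))%:R).
  by rewrite mulr_ege1 // ler1n.
rewrite IH -scalemxAr -map_mxM {1}(entries_gcd_scale (_ *m _)) map_mxZ scalerA.
by rewrite (PhiM [:: l] u).
Qed.

End RealProduct.

(** * Prefixes of the limit word *)

Lemma fib_word_prefix k d : exists s, fib_word (d + k).+2 = fib_word k.+2 ++ s.
Proof.
elim: d => [|d [s IH]]; first by exists [::]; rewrite cats0.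
by exists (s ++ fib_word (d + k).+1); rewrite addSn fib_wordS IH catA.
Qed.

Section WordLimit.
Variables (f : nat -> letter) (Hf : word_limit fib_word f).

Lemma word_limit_take i k0 :
  exists2 m, (k0 <= m)%N &
    (i < size (fib_word m))%N /\ take i (fib_word m) = mkseq f i.
Proof.
have [n _ Hn] := Hf i; exists (n + k0 + i).+2; first by lia.
split; last by apply: Hn => /=; lia.
by apply: leq_trans (size_fib_word _); rewrite ltnS leq_addl.
Qed.

(** This places every $W_k$ with $k\ge2$ among the $U_i$, so the norms of the $U_i$ are
    unbounded. *)
Lemma mkseq_word_limit k : mkseq f (size (fib_word k.+2)) = fib_word k.+2.
Proof.
have [n _ Hn] := Hf (size (fib_word k.+2)).
have [s E] := fib_word_prefix k n.
rewrite -(Hn (n + k).+2); last by rewrite /=; lia.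
by rewrite E take_size_cat.
Qed.

End WordLimit.

(** * Alignment and its transfer to prefixes *)

Section AlmostAligned.
Variables (R : realType) (xi : R).

(* Homogeneous form of |(xi, -1) M| <= C |det M| / |M|. *)
Definition aligned (C : R) (M : 'M[R]_2) : bool :=
  `|(\row_(j < 2) [:: xi; -1]`_j) *m M| * `|M| <= C * `|\det M|.

Lemma alignedZ C a M : a != 0 -> aligned C (a *: M) = aligned C M.
Proof.
move=> a0; rewrite /aligned -scalemxAr !mx_normZ detZ normrM normrX.
by rewrite mulrACA -expr2 (mulrCA C) ler_pM2l // exprn_gt0 // normr_gt0.
Qed.

(** Multiply the goal by [|det V| * |U V|]: [norm_det_row] applied to the row [v U] replaces
    [|det V| * |v U|] by [2 * |v U V| * |V|], and [kappa] absorbs [|U| * |V|]. *)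
Lemma aligned_prefix C kappa (U V : 'M[R]_2) :
  0 <= kappa -> \det V != 0 -> U *m V != 0 ->
  `|U| * `|V| <= kappa * `|U *m V| ->
  aligned C (U *m V) -> aligned (2 * kappa * C) U.
Proof.
rewrite /aligned => k0 dV UV0 UVk; rewrite det_mulmx normrM mulmxA => alUV.
set v := \row_j _ in alUV *.
have dV0 : 0 < `|\det V| by rewrite normr_gt0.
have UV_gt0 : 0 < `|U *m V| by rewrite normr_gt0.
rewrite -(ler_pM2r (mulr_gt0 dV0 UV_gt0)).
have vU := norm_det_row (v *m U) V.
apply: (@le_trans _ _ (2 * `|v *m U *m V| * `|V| * (`|U| * `|U *m V|))).
  rewrite [leLHS](_ : _ = `|\det V| * `|v *m U| * (`|U| * `|U *m V|)); last by ring.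
  by rewrite ler_wpM2r // mulr_ge0.
rewrite [leLHS](_ : _ = `|U| * `|V| * (2 * (`|v *m U *m V| * `|U *m V|))); last by ring.
apply: (@le_trans _ _ (kappa * `|U *m V| * (2 * (C * (`|\det U| * `|\det V|))))).
  by rewrite ler_pM ?mulr_ge0 // ler_pM2l.
by rewrite le_eqVlt; apply/orP; left; apply/eqP; ring.
Qed.

End AlmostAligned.

(** * Consequences of admissibility and association *)

Lemma det_map_intr_neq0 (R : realType) (A : 'M[int]_2) :
  A \in calP -> \det (map_mx intr A : 'M[R]_2) != 0.
Proof. by case/andP => _ dA; rewrite det_map_mx intr_eq0. Qed.

Lemma absdetE (R : realType) (A : 'M[int]_2) :
  absdet R A = `|\det (map_mx intr A : 'M[R]_2)|.
Proof. by rewrite /absdet det_map_mx intr_norm. Qed.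

Lemma mnorm_gt0 (R : realType) (A : 'M[int]_2) : A \in calP -> 0 < mnorm R A.
Proof.
move/(det_map_intr_neq0 R); rewrite normr_gt0; apply: contraNneq => ->.
by rewrite det0.
Qed.

Lemma absdet_ge1 (R : realType) (A : 'M[int]_2) : A \in calP -> 1 <= absdet R A.
Proof. by case/andP => _ dA; rewrite /absdet ler1z -gtz0_ge1 normr_gt0. Qed.

(** If the quadratic form attached to [N] vanished at [xi], its integer coefficients would be zero
    and [N] skew-symmetric. Transposing [N] does not change the form, so both parities of [i] are
    covered. *)
Lemma admissible_row_bound (R : realType) (xi : R) (W : nat -> 'M[int]_2) :
  ~ rational xi -> ~ quadratic xi -> admissible W ->
  let M i : 'M[R]_2 := map_mx intr (W i) in
  exists2 K : R, 0 < K & forall i, (1 <= i)%N ->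
    `|M i| <= K * (`|M i 0 0 + M i 0 1 * xi|
                   + `|(\row_(j < 2) [:: xi; -1]`_j) *m M i|).
Proof.
move=> xiNrat xiNquad [N [_ _ NN sym]] M.
pose NR : 'M[R]_2 := map_mx intr N.
have form_neq0 : xi ^+ 2 * NR 0 0 - xi * (NR 0 1 + NR 1 0) + NR 1 1 != 0.
  apply/eqP => form0; apply: NN.
  have [|p0 /eqP] := @quadratic_relation0 _ xi (N 0 0) (- (N 0 1 + N 1 0)) (N 1 1)
    xiNrat xiNquad.
    by rewrite -form0 !mxE rmorphN rmorphD /=; ring.
  rewrite oppr_eq0 addr_eq0 => /eqP qr s0.
  apply/matrixP; apply: forall_ord2; apply: forall_ord2;
    by rewrite !mxE ?p0 ?s0 ?qr ?oppr0 ?opprK.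
have [K1 K10 HK1] := mx_norm_le_row form_neq0.
have [|K2 K20 HK2] := @mx_norm_le_row _ xi NR^T.
  by rewrite !(mxE trmx_key) [NR 1 0 + _]addrC.
exists (K1 + K2); first exact: addr_gt0.
move=> i i1; set t := `|_| + _.
have t0 : 0 <= t by apply: addr_ge0.
have := sym i i1; rewrite /=.
case: (odd i) => symi.
  rewrite (le_trans (HK2 (M i) _)) //; last by rewrite ler_wpM2r // lerDr ltW.
  by rewrite /M /NR map_trmx -map_mxM map_trmx symi.
rewrite (le_trans (HK1 (M i) _)) //; last by rewrite ler_wpM2r // lerDl ltW.
by rewrite /M /NR -map_mxM map_trmx symi.
Qed.

Lemma associated_cone_blocks (R : realType) (xi : R) (W : nat -> 'M[int]_2) :
  ~ rational xi -> ~ quadratic xi -> associated xi W ->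
  exists2 eta : R, 0 < eta & exists2 k, (1 <= k)%N &
    forall b : bool, exists s : bool, forall i j,
    1 <= ((-1) ^+ s *: (cone_inv xi eta *m map_mx intr (W (k + b)%N)
                        *m cone_mx xi eta)) i j.
Proof.
move=> xiNrat xiNquad [[WP _] Wunb adm [[c [c' [c0 _ Wgrow]]] [l [L [_ L0 Wlin]]] _]].
have [K K0 HK] := admissible_row_bound xiNrat xiNquad adm.
have [eta eta0 [B HB]] := cone_conj_ge1 xi K0 L0.
exists eta => //.
pose B1 := Num.max B 1.
(* The bound [B1 / c] serves the next block: $\|W_{k+1}\|\ge c\|W_k\|^\gamma\ge c\|W_k\|$, as
   $\gamma\ge1$ and $\|W_k\|\ge1$. *)
have [k k1 Bk] := Wunb (Num.max B1 (B1 / c)).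
exists k => //.
have good i : (1 <= i)%N -> B1 <= mnorm R (W i) -> exists s : bool, forall a b,
    1 <= ((-1) ^+ s *: (cone_inv xi eta *m map_mx intr (W i)
                        *m cone_mx xi eta)) a b.
  move=> i1; rewrite ge_max => /andP[Bi one_le].
  apply: HB; [exact: HK| |exact: Bi].
  have /andP[_] := Wlin i i1; move/le_trans; apply.
  by rewrite -[leRHS]mulr1 ler_pM2l // invf_le1 // (lt_le_trans ltr01).
move: Bk; rewrite gt_max => /andP[/ltW Bk /ltW Bck].
case; rewrite ?addn0 ?addn1; last exact: good.
apply: good => //; have /andP[+ _] := Wgrow k k1; apply: le_trans.
have one_le : 1 <= mnorm R (W k) by apply: le_trans Bk; rewrite le_max lexx orbT.
rewrite mulrC -ler_pdivrMr // (le_trans Bck) //.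
apply: le1r_powR => //; rewrite /golden ler_pdivlMr // mul1r.
rewrite -[2]/(1 + 1) lerD2l -{1}sqrtr1 ler_sqrt //; lra.
Qed.

(** * Quasi-multiplicativity of the norm on cut Fibonacci words *)

Section QuasiMultiplicative.
Variables (R : realType) (xi eta : R) (Phi : seq letter -> 'M[int]_2) (k : nat).
Hypotheses (HPhi : star_morphism Phi) (k_gt0 : (0 < k)%N) (eta_gt0 : 0 < eta).
Hypothesis blocks : forall b : bool, exists s : bool, forall i j,
  1 <= ((-1) ^+ s *: (cone_inv xi eta *m map_mx intr (Phi (fib_word (k + b)))
                      *m cone_mx xi eta)) i j.

Let Psi := real_prod R Phi.
Let G := cone_mx xi eta.
Let H := cone_inv xi eta.

Lemma block_conj_ge1 (b : bool) : exists s : bool, forall i j,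
  1 <= ((-1) ^+ s *: (H *m Psi (fib_word (k + b)) *m G)) i j.
Proof.
have [s Hs] := blocks b; exists s => i j.
rewrite /Psi; have [lam lam1 ->] := real_prod_scale R HPhi (fib_word (k + b)).
rewrite -scalemxAr -scalemxAl scalerA mulrC -scalerA mxE.
by rewrite (le_trans lam1) // ler_peMr // (le_trans ler01).
Qed.

(** The bound is 0 and not 1 because the empty list gives the identity. *)
Lemma blocks_conj_nonneg (bs : seq bool) : exists s : bool, forall i j,
  0 <= ((-1) ^+ s *: (H *m Psi (flatten [seq fib_word (k + b) | b : bool <- bs])
                      *m G)) i j.
Proof.
have GH : G *m H = 1%:M by apply: cone_mxK.
elim: bs => [|b bs [s IH]].
  exists false => i j; rewrite mulmx1 expr0 scale1r.
  have HG : H *m G = 1%:M by apply: mulmx1C.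
  by rewrite HG mxE ler0n.
have [t Ht] := block_conj_ge1 b.
exists (t (+) s) => /=; rewrite /Psi real_prod_cat.
apply: sign_nonneg_conjM => // i j.
exact: le_trans ler01 (Ht i j).
Qed.

Lemma fib_split_norm_le : exists2 kappa : R, 0 <= kappa & forall m i,
  (k <= m)%N -> (i < size (fib_word m))%N ->
  `|Psi (take i (fib_word m))| * `|Psi (drop i (fib_word m))|
    <= kappa * `|Psi (fib_word m)|.
Proof.
have GH : G *m H = 1%:M by apply: cone_mxK.
have [D D1 HD] := real_prod_norm_le R Phi.
have D0 : 0 <= D by apply: le_trans D1.
pose N := (size (fib_word k) + size (fib_word k.+1))%N.
have HDN (b : bool) u : (size u <= size (fib_word (k + b)))%N -> `|Psi u| <= D ^+ N.
  move=> su; apply: le_trans (HD u) _; apply: ler_weXn2l => //.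
  apply: leq_trans su _; rewrite /N.
  by case: b; rewrite ?addn1 ?addn0 ?leq_addl ?leq_addr.
have DN0 : 0 <= D ^+ N by apply: exprn_ge0.
(* Each half of the word is a run of whole blocks times a piece of norm at most [D ^+ N], which
   costs [2 * D ^+ N] twice; the cube comes from the change of basis. *)
exists (4 * (D ^+ N) ^+ 2 * (4 * `|G| * `|H|) ^+ 3).
  by rewrite !mulr_ge0 // exprn_ge0 // !mulr_ge0.
move=> m i km im.
have [bs E] := fib_word_blocks (m - k) k_gt0.
rewrite subnK // in E; rewrite E in im *.
have [bs1 [b [bs2 [j [bsE -> ->]]]]] := flatten_map_split im.
have [s1 H1] := blocks_conj_nonneg bs1.
have [s2 H2] := blocks_conj_nonneg bs2.
have [s Hs] := block_conj_ge1 b.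
have := mx_norm_mul3_conj ltr01 GH H1 Hs H2.
rewrite bsE map_cat flatten_cat /= /Psi !real_prod_cat -/Psi mulmxA mul1r.
set x := Psi (flatten _); set y := Psi (flatten _); set z := `|_ *m _ *m _|.
set g := _ ^+ 3 => main.
have p_le := @HDN b (take j (fib_word (k + b))).
have s_le := @HDN b (drop j (fib_word (k + b))).
rewrite size_take_min geq_minr in p_le; rewrite size_drop leq_subr in s_le.
apply: (@le_trans _ _ ((2 * `|x| * D ^+ N) * (2 * D ^+ N * `|y|))).
  apply: ler_pM => //; apply: le_trans (mx_norm_mul2 _ _) _.
    by apply: ler_wpM2l; rewrite ?mulr_ge0 // p_le.
  by apply: ler_wpM2r => //; apply: ler_wpM2l => //; apply: s_le.
rewrite [leLHS](_ : _ = 4 * (D ^+ N) ^+ 2 * (`|x| * `|y|)); last by ring.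
by rewrite -[leRHS]mulrA ler_wpM2l // mulr_ge0 // exprn_ge0.
Qed.

End QuasiMultiplicative.

(** * Alignment of the prefixes and bad approximability *)

Lemma mnorm_star_le (R : realType) (A B : 'M[int]_2) :
  A \in calP -> B \in calP -> mnorm R (star A B) <= 2 * mnorm R A * mnorm R B.
Proof.
move=> PA PB; apply: le_trans (mx_norm_mul2 _ _).
rewrite -map_mxM [X in map_mx _ X](entries_gcd_scale (A *m B)) map_mxZ mx_normZ.
have : 1 <= `|(entries_gcd (A *m B))%:R| :> R by rewrite normr_nat ler1n gcd_mul_gt0.
by move=> gcd_ge1; rewrite ler_peMl // /mnorm normr_ge0.
Qed.

Lemma aligned_prefixes (R : realType) (xi : R) (W : nat -> 'M[int]_2)
    (f : nat -> letter) (Phi : seq letter -> 'M[int]_2) :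
  ~ rational xi -> ~ quadratic xi -> associated xi W -> word_limit fib_word f ->
  star_morphism Phi -> (forall k, (1 <= k)%N -> Phi (fib_word k) = W k) ->
  exists2 C : R, 0 <= C &
    forall i, aligned xi C (map_mx intr (Phi (mkseq f i))).
Proof.
move=> xiNrat xiNquad HW Hf HPhi HPhiW.
have [PhiP _ _] := HPhi.
have [eta eta0 [k k1 blocksW]] := associated_cone_blocks xiNrat xiNquad HW.
have blocks (b : bool) : exists s : bool, forall i j,
    1 <= ((-1) ^+ s *: (cone_inv xi eta *m map_mx intr (Phi (fib_word (k + b)))
                        *m cone_mx xi eta)) i j.
  by rewrite HPhiW ?ltn_addr //; apply: blocksW.
have [kappa kappa0 split_le] := fib_split_norm_le HPhi k1 eta0 blocks.
have [_ _ _ [_ [l [L [_ L0 Wlin]]] [c [c' [c0 _ Wdet]]]]] := HW.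
have scale_neq0 (lam : R) : 1 <= lam -> lam != 0.
  by move=> lam1; rewrite gt_eqF // (lt_le_trans ltr01).
have alW m : (1 <= m)%N -> aligned xi (L / c) (map_mx intr (W m)).
  move=> m1; rewrite /aligned -absdetE.
  have /andP[_ Wlin_m] := Wlin m m1; have /andP[+ _] := Wdet m m1.
  rewrite mulr1 => Wdet_m.
  have Wm0 : 0 < mnorm R (W m) by apply: mnorm_gt0; rewrite -HPhiW.
  rewrite -ler_pdivlMr // (le_trans Wlin_m) // ler_pM2r ?invr_gt0 //.
  by rewrite mulrAC ler_pdivlMr // ler_pM2l.
exists (2 * kappa * (L / c)).
  by rewrite !mulr_ge0 // ?invr_ge0 ltW.
move=> i; have [m km [im <-]] := word_limit_take Hf i k.
have [lam lam1 PsiU] := real_prod_scale R HPhi (take i (fib_word m)).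
have [lamV lamV1 PsiV] := real_prod_scale R HPhi (drop i (fib_word m)).
have [lamW lamW1 PsiW] := real_prod_scale R HPhi (fib_word m).
have PsiUV := real_prod_cat R Phi (take i (fib_word m)) (drop i (fib_word m)).
rewrite cat_take_drop in PsiUV.
have m1 := leq_trans k1 km.
(* Alignment ignores non-zero scalars, so the unreduced product may replace $U_i$. *)
rewrite -(alignedZ _ _ _ (scale_neq0 _ lam1)) -PsiU.
have det_neq0 u (a : R) : 1 <= a -> \det (a *: map_mx intr (Phi u) : 'M[R]_2) != 0.
  move=> a1; rewrite detZ; apply: mulf_neq0; last exact: det_map_intr_neq0.
  by rewrite expf_neq0 ?scale_neq0.
apply: (aligned_prefix kappa0 (V := real_prod R Phi (drop i (fib_word m)))).
- by rewrite PsiV det_neq0.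
- rewrite -PsiUV PsiW; apply: contraNneq (det_neq0 (fib_word m) _ lamW1) => ->.
  by rewrite det0.
- by rewrite -PsiUV; apply: split_le.
- by rewrite -PsiUV PsiW alignedZ ?scale_neq0 // HPhiW // alW.
Qed.

(* The norms grow at most geometrically, hence some |U_i| is comparable to any
   given q; then (p, -q) U_i is a nonzero integer row, so it has norm at least 1. *)
Lemma badly_approximable_of_matrices (R : realType) (xi : R)
    (U : nat -> 'M[int]_2) (K C : R) :
  ~ rational xi -> 0 < K -> 0 < C ->
  (forall i, U i \in calP) -> mnorm R (U 0) <= 1 ->
  (forall i, mnorm R (U i.+1) <= K * mnorm R (U i)) ->
  (forall i, (1 <= i)%N -> linorm xi (U i) <= C / mnorm R (U i)) ->
  (forall B : R, exists i, B < mnorm R (U i)) ->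
  badly_approximable xi.
Proof.
move=> xiNrat K0 C0 UP U0 Ugrow Ulin Uunb; split => //.
(* The argument yields [2 * c] as lower bound for [|q xi - p| * q]; the factor 2 gives the strict
   inequality. *)
pose c := (4 * K * (2 * C + 2))^-1.
have C2 : 0 < 2 * C + 2 by rewrite addr_gt0 // mulr_gt0.
have c0 : 0 < c by rewrite invr_gt0 !mulr_gt0.
exists c => // p q q0.
have qR0 : 0 < q%:~R :> R by rewrite ltr0z.
have q1 : 1 <= q%:~R :> R by rewrite ler1z.
(* A norm [X >= T] makes [q * C / X] at most 1/2; the summand 2 excludes index 0, where the norm is
   at most 1. *)
pose T : R := 2 * q%:~R * C + 2.
have exT : exists i, T <= mnorm R (U i).
  by have [i /ltW] := Uunb T; exists i.
have T_gt1 : 1 < T.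
  have qC0 : 0 < q%:~R * C by rewrite mulr_gt0.
  by rewrite /T; lra.
have qC : T <= (2 * C + 2) * q%:~R.
  by rewrite /T; lra.
case: (ex_minnP exT) => -[|i] Ti imin.
  by have := lt_le_trans T_gt1 (le_trans Ti U0); rewrite ltxx.
have Ui_lt : mnorm R (U i) < T.
  by rewrite ltNge; apply/negP => /imin; rewrite ltnn.
set X := mnorm R (U i.+1) in Ti.
have X0 : 0 < X by apply: lt_trans (lt_le_trans T_gt1 Ti).
have XK : X <= K * ((2 * C + 2) * q%:~R).
  rewrite (le_trans (Ugrow i)) // ler_pM2l //.
  exact: le_trans (ltW Ui_lt) qC.
pose A : 'M[R]_2 := map_mx intr (U i.+1).
pose r : 'rV[R]_2 := \row_(j < 2) [:: p%:~R; - q%:~R]`_j.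
have rA0 : 0 < `|r *m A|.
  have r0 : 0 < `|r|.
    rewrite normr_gt0; apply: contraTneq qR0 => /matrixP/(_ 0 1).
    by rewrite !mxE /= => /eqP; rewrite oppr_eq0 => /eqP ->; rewrite ltxx.
  have dA : 0 < `|\det A| by rewrite normr_gt0 det_map_intr_neq0.
  have := lt_le_trans (mulr_gt0 dA r0) (norm_det_row r A).
  by rewrite pmulr_lgt0 // pmulr_rgt0.
have [i0 [j rAj]] := mx_norm_attained (r *m A).
have test : 1 <= q%:~R * linorm xi (U i.+1) + `|q%:~R * xi - p%:~R| * X.
  have rAjE : (r *m A) i0 j = (p * U i.+1 0 j - q * U i.+1 1 j)%:~R.
    by rewrite mulmx2E !mxE /= rmorphB !rmorphM /= mulNr.
  have ge1 : 1 <= `|(r *m A) i0 j|.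
    move: rA0; rewrite rAj rAjE -intr_norm ltr0z ler1z.
    by rewrite -gtz0_ge1.
  apply: le_trans ge1 _.
  (* The row [(p, -q)] is [q] times [(xi, -1)] minus [(q xi - p, 0)]. *)
  have -> : (r *m A) i0 j = q%:~R * (xi * A 0 j - A 1 j)
      - (q%:~R * xi - p%:~R) * A 0 j.
    by rewrite rAjE !mxE rmorphB !rmorphM /=; ring.
  rewrite (le_trans (ler_normB _ _)) // !normrM (gtr0_norm qR0) lerD //.
    by rewrite ler_pM2l // linform_entry_le.
  by rewrite ler_wpM2l // mx_entry_le_norm.
have lin_small : q%:~R * linorm xi (U i.+1) <= 1 / 2.
  apply: (@le_trans _ _ (q%:~R * (C / X))); first by rewrite ler_pM2l // Ulin.
  rewrite mulrA ler_pdivrMr //.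
  by have := Ti; rewrite /T; lra.
have X_far : 1 / 2 <= `|q%:~R * xi - p%:~R| * X by lra.
have far : 2 * c <= `|q%:~R * xi - p%:~R| * q%:~R.
  have : 1 / 2 <= `|q%:~R * xi - p%:~R| * (K * ((2 * C + 2) * q%:~R)).
    by apply: le_trans X_far _; rewrite ler_wpM2l.
  rewrite (_ : 2 * c = 1 / 2 / (K * (2 * C + 2))); last first.
    by rewrite /c; field; rewrite !gt_eqF.
  move=> X_far'; rewrite ler_pdivrMr; last by rewrite mulr_gt0.
  by apply: le_trans X_far' _; rewrite le_eqVlt; apply/orP; left; apply/eqP; ring.
have -> : xi - p%:~R / q%:~R = (q%:~R * xi - p%:~R) / q%:~R.
  by field; rewrite gt_eqF.
rewrite normrM normfV (gtr0_norm qR0) ltr_pdivlMr //.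
have -> : c / q%:~R ^+ 2 * q%:~R = c / q%:~R by field; rewrite gt_eqF.
rewrite ltr_pdivrMr //; lra.
Qed.

Theorem theorem2p3 (R : realType) (xi : R) (W : nat -> 'M[int]_2)
    (f : nat -> letter) (Phi : seq letter -> 'M[int]_2)
    (Hxi : extremal xi) (HW : associated xi W)
    (Hf : word_limit fib_word f)
    (HPhi : star_morphism Phi)
    (HPhiW : forall k, (1 <= k)%N -> Phi (fib_word k) = W k) :
  let U (i : nat) := Phi (mkseq f i) in
  asymp (fun i => linorm xi (U i)) (fun i => absdet R (U i) / mnorm R (U i)) /\
  ((exists B : R, forall i, (1 <= i)%N -> absdet R (U i) <= B) ->
   badly_approximable xi).
Proof.
move=> U; have [xiNrat xiNquad _] := Hxi.
have [PhiP Phi0 PhiM] := HPhi.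
have [C C0 alU] := aligned_prefixes xiNrat xiNquad HW Hf HPhi HPhiW.
have Unorm0 i : 0 < mnorm R (U i) by apply: mnorm_gt0; apply: PhiP.
(* [C] may be zero, whereas [asymp] requires a positive constant. *)
have upper i : linorm xi (U i) <= (C + 1) * (absdet R (U i) / mnorm R (U i)).
  rewrite mulrA ler_pdivlMr // absdetE (le_trans (alU i)) //.
  by rewrite ler_wpM2r // lerDl.
have C1 : 0 < C + 1 by rewrite ltr_wpDl.
split.
  have v0 : 0 < `|\row_(j < 2) [:: xi; -1]`_j : 'rV[R]_2|.
    by rewrite normr_gt0 linform_neq0.
  exists (`|\row_(j < 2) [:: xi; -1]`_j : 'rV[R]_2| / 2), (C + 1).
  split => //; first by rewrite divr_gt0.
  move=> i _; rewrite upper andbT mulrA ler_pdivrMr // mulrAC ler_pdivrMr //.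
  rewrite mulrC absdetE (le_trans (norm_det_row _ _)) //.
  by rewrite -mulrA mulrC.
case=> B HB.
have B1 : 1 <= B by apply: le_trans (HB 1%N isT); apply: absdet_ge1; apply: PhiP.
have B0 : 0 < B by apply: lt_le_trans B1.
pose K := 2 * (mnorm R (Phi [:: La]) + mnorm R (Phi [:: Lb])).
have nl0 l : 0 < mnorm R (Phi [:: l]) by apply: mnorm_gt0; apply: PhiP.
apply: (@badly_approximable_of_matrices _ _ U K ((C + 1) * B)) => //.
- by rewrite mulr_gt0 // addr_gt0.
- by rewrite mulr_gt0.
- by move=> i; apply: PhiP.
- rewrite /U Phi0 /mnorm; apply: mx_norm_leP => // i j.
  by rewrite !mxE; case: eqP => _; rewrite ?normr1 ?normr0.
- move=> i; rewrite /U mkseqS -cats1 PhiM.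
  rewrite (le_trans (mnorm_star_le _ (PhiP _) (PhiP _))) // mulrAC.
  rewrite (ler_pM2r (Unorm0 i)) /K ler_pM2l //; have := nl0 La; have := nl0 Lb.
  by case: (f i); lra.
- move=> i i1; rewrite (le_trans (upper i)) // -mulrA ler_pM2l //.
  by apply: ler_wpM2r; [rewrite invr_ge0; exact/ltW/Unorm0|exact: HB].
- move=> B'; have [_ Wunb _ _] := HW.
  (* The word $w_1=b$ is not a prefix of the limit word; asking for a norm beyond that of [W 1]
     rules out index 1. *)
  have [[//|[|k]] k1] := Wunb (Num.max B' (mnorm R (W 1%N))).
    by rewrite gt_max ltxx andbF.
  rewrite gt_max => /andP[Bk _]; exists (size (fib_word k.+2)).
  by rewrite /U (mkseq_word_limit Hf) HPhiW.
Qed.
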